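(* For every nonnegative rational number $r$ and every real $q>0$, $[\![ r ]\!]_q = q\,[r]_q$.
   Context: Snake posets. A filter of a poset is an up-closed subset. $P_0$ is the empty poset, $P_1$ is the one-element poset $\{0\}$, and for $n\ge2$ with binary expansion $b_m b_{m-1}\cdots b_0$ ($b_m=1$, $n=\sum_i b_i2^i$), $P_n$ is the poset on $\{0,\dots,m\}$ with covering relations $i+1\gtrdot i$ (i.e. $i+1$ covers $i$) if $b_i=0$ and $i+1\lessdot i$ ($i+1$ is covered by $i$) if $b_i=1$, for $0\le i<m$, and no other relations than those implied. Let $\mathrm{fusc}(0)=0$, $\mathrm{fusc}(1)=1$, $\mathrm{fusc}(n)=\mathrm{fusc}(n/2)$ for even $n>1$, and $\mathrm{fusc}(n)=\mathrm{fusc}((n-1)/2)+\mathrm{fusc}((n+1)/2)$ for odd $n>1$. For rational $r\ge0$, $S_r:=P_n$ for the unique integer $n\ge0$ with $r=\mathrm{fusc}(n)/\mathrm{fusc}(n+1)$. Definition of $[\![ r ]\!]_q$: let $i_n(q)$ (resp. $o_n(q)$) be the sum of $q^{|F|}$ over the filters $F$ of $P_n$ that include (resp. omit) $0$, so that $i_0(q)=0$, $o_0(q)=1$, $i_1(q)=q$, $o_1(q)=1$. If $S_r=P_n$ then $[\![ r ]\!]_q=i_n(q)/o_n(q)$; equivalently, it is the probability that a random filter of $S_r$ (chosen with probability proportional to $q^{|F|}$) includes $0$, divided by the probability that it omits $0$. Definition of $[r]_q$ (Morier-Genoud–Ovsienko $q$-rational): $[0]_q=0$; for rational $r>0$ write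 $r=[a_1;a_2,\dots,a_{2s}]$ as a regular continued fraction of even length with $a_1\ge0$ and $a_i\ge1$ for $i\ge2$, and set $$[r]_q=[a_1]_q+\cfrac{q^{a_1}}{[a_2]_{q^{-1}}+\cfrac{q^{-a_2}}{[a_3]_q+\cfrac{q^{a_3}}{[a_4]_{q^{-1}}+\cfrac{q^{-a_4}}{\ddots+\cfrac{q^{a_{2s-1}}}{[a_{2s}]_{q^{-1}}}}}}},$$ where $[a]_q=1+q+\cdots+q^{a-1}$ for integers $a\ge0$. These satisfy the known relations $[r+1]_q=q[r]_q+1$ for $r\ge 0$ and $[1/r]_q=1/[r]_{1/q}$ for $r>0$, which together with $[0]_q=0$ determine $[r]_q$ for all nonnegative rational $r$. *)

(* Defs.v *)
From HB Require Import structures.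
From mathcomp Require Import all_boot all_order all_algebra.
From mathcomp Require Import ring lra zify.
From mathcomp Require Import classical_sets.

Set Implicit Arguments.
Unset Strict Implicit.
Unset Printing Implicit Defensive.

Import Order.TTheory GRing.Theory Num.Theory.
Local Open Scope ring_scope.

Definition bit (n i : nat) : bool := odd (n %/ 2 ^ i).

Definition snake_size (n : nat) : nat :=
  if n == 0%N then 0%N else (trunc_log 2 n).+1.

(* The carrier of P_n. It is an alias of the ordinals so that it can carry the
   snake order instead of the natural order of 'I_k. *)
Definition snake (n : nat) : Type := 'I_(snake_size n).
HB.instance Definition _ n := Finite.copy (snake n) 'I_(snake_size n).

Definition snake_val n (x : snake n) : nat := nat_of_ord x.

(* [snake_cover x y]: y covers x. *)
Definition snake_cover n (x y : snake n) : bool :=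
  let i := snake_val x in let j := snake_val y in
  ((j == i.+1) && ~~ bit n i) || ((i == j.+1) && bit n j).

Definition snake_le n (x y : snake n) : bool := connect (@snake_cover n) x y.

(* Every covering step raises the height by 1, whence antisymmetry. *)
Fixpoint snake_height (n i : nat) : int :=
  if i is j.+1 then snake_height n j + (if bit n j then -1 else 1) else 0.

Lemma snake_height_path n (x : snake n) p : path (@snake_cover n) x p ->
  snake_height n (snake_val (last x p)) =
  snake_height n (snake_val x) + (size p)%:Z.
Proof.
elim: p x => [|y p IH] x /=; first by rewrite addr0.
case/andP=> hxy /IH ->; move: hxy; rewrite /snake_cover.
case/orP=> /andP[/eqP -> /= hb]; last by rewrite hb; lia.
by rewrite (negbTE hb); lia.
Qed.

Lemma snake_le_refl n : reflexive (@snake_le n).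
Proof. by move=> x; exact: connect0. Qed.

Lemma snake_le_anti n : antisymmetric (@snake_le n).
Proof.
move=> x y /andP[/connectP[p hp ey] /connectP[s hs ex]].
have := snake_height_path hp; have := snake_height_path hs.
rewrite -ey -ex => -> /esym/eqP; rewrite -addrA -subr_eq0 [_ + _ - _]addrC.
rewrite addKr -PoszD eqz_nat addn_eq0 => /andP[_ /nilP hp0].
by rewrite ey hp0.
Qed.

Lemma snake_le_trans n : transitive (@snake_le n).
Proof. by move=> y x z; exact: connect_trans. Qed.

Fact snake_display : Order.disp_t. Proof. exact: Order.Disp tt tt. Qed.

HB.instance Definition _ n := Order.Le_isPOrder.Build snake_display (snake n)
  (@snake_le_refl n) (@snake_le_anti n) (@snake_le_trans n).

Lemma snake_leE n (x y : snake n) : (x <= y)%O = connect (@snake_cover n) x y.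
Proof. by []. Qed.

Definition is_filter d (T : finPOrderType d) (F : {set T}) : bool :=
  [forall x in F, forall y, (x <= y)%O ==> (y \in F)].

(* Stated with an existential because P_0 has no element 0. *)
Definition includes0 n (F : {set snake n}) : bool :=
  [exists x in F, snake_val x == 0%N].

Definition i_gf (K : fieldType) (n : nat) (q : K) : K :=
  \sum_(F : {set snake n} | is_filter F && includes0 F) q ^+ #|F|.

Definition o_gf (K : fieldType) (n : nat) (q : K) : K :=
  \sum_(F : {set snake n} | is_filter F && ~~ includes0 F) q ^+ #|F|.

(* The first argument is fuel; the recursion equations are proved below. *)
Fixpoint fusc_rec (k n : nat) : nat :=
  if k is k'.+1 then
    if (n <= 1)%N then n
    else if odd n then (fusc_rec k' n./2 + fusc_rec k' n./2.+1)%N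
    else fusc_rec k' n./2
  else n.

Definition fusc (n : nat) : nat := fusc_rec n n.

Lemma fusc_rec_fuel k n : (n <= k)%N -> fusc_rec k n = fusc n.
Proof.
rewrite /fusc; have [m] := ubnP k; elim: m k n => // m IH [|k] [|n] hk // hnk.

rewrite /fusc_rec -/fusc_rec.
case: ifP => // hn; case: ifP => ho; last by rewrite (IH k) ?(IH n) //; lia.
by congr (_ + _)%N; rewrite (IH k) ?(IH n) //; lia.
Qed.

Lemma fusc0 : fusc 0 = 0%N. Proof. by []. Qed.

Lemma fusc1 : fusc 1 = 1%N. Proof. by []. Qed.

Lemma fusc_even n : ~~ odd n -> (1 < n)%N -> fusc n = fusc (n %/ 2).
Proof.
case: n => // n ho hn; rewrite divn2 {1}/fusc /fusc_rec -/fusc_rec.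
by rewrite leqNgt hn /= -/(odd n.+1) (negbTE ho) fusc_rec_fuel //; lia.
Qed.

Lemma fusc_odd n : odd n -> (1 < n)%N ->
  fusc n = (fusc ((n - 1) %/ 2) + fusc ((n + 1) %/ 2))%N.
Proof.
case: n => // n ho hn; rewrite {1}/fusc /fusc_rec -/fusc_rec.
rewrite leqNgt hn /= -/(odd n.+1) ho !fusc_rec_fuel; try lia.
by congr (fusc _ + fusc _)%N; lia.
Qed.

Lemma fusc_double n : fusc n.*2 = fusc n.
Proof.
case: n => // n; rewrite fusc_even ?odd_double //.
by congr fusc; lia.
Qed.

Lemma fusc_doubleS n : fusc n.*2.+1 = (fusc n + fusc n.+1)%N.
Proof.
case: n => // n; rewrite fusc_odd /= ?odd_double //.
by congr (fusc _ + fusc _)%N; lia.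
Qed.

Lemma fusc_gt0 n : (0 < n)%N -> (0 < fusc n)%N.
Proof.
elim/ltn_ind: n => n IH hn.
have [ho|ho] := boolP (odd n).
  have -> : n = (n./2.*2.+1)%N by lia.
  rewrite fusc_doubleS; have [h0|h0] := posnP n./2; first by rewrite h0.
  by have := IH n./2; lia.
have -> : n = (n./2.*2)%N by lia.
by rewrite fusc_double; apply: IH; lia.
Qed.

Definition fusc_ratio (n : nat) : rat := (fusc n)%:R / (fusc n.+1)%:R.

Lemma rat_ge0_ind (P : rat -> Prop) :
  (forall a b : nat, (0 < b)%N ->
    (forall c d : nat, (0 < d)%N -> (c + d < a + b)%N -> P (c%:R / d%:R)) ->
    P (a%:R / b%:R)) ->
  forall r : rat, 0 <= r -> P r.
Proof.
move=> H r hr.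
have -> : r = `|numq r|%N%:R / `|denq r|%N%:R.
  rewrite -{1}[r]divq_num_den !natr_absz.
  by rewrite !ger0_norm ?numq_ge0 ?denq_ge0.
have : (0 < `|denq r|)%N by rewrite absz_gt0 denq_neq0.
move: `|numq r|%N `|denq r|%N => a b.
have [k] := ubnP (a + b); elim: k a b => // k IH a b hk hb.
by apply: H => // c d hd h; apply: IH => //; lia.
Qed.

Lemma fusc_ratio0 : fusc_ratio 0 = 0.
Proof. by rewrite /fusc_ratio fusc0 mul0r. Qed.

Lemma fusc_ratio_ge0 n : 0 <= fusc_ratio n.
Proof. by rewrite /fusc_ratio divr_ge0. Qed.

Lemma fusc_ratio_gt0 n : (0 < n)%N -> 0 < fusc_ratio n.
Proof. by move=> hn; rewrite /fusc_ratio divr_gt0 // ltr0n fusc_gt0. Qed.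

Lemma fusc_ratio_double n :
  fusc_ratio n.*2 = fusc_ratio n / (1 + fusc_ratio n).
Proof.
rewrite /fusc_ratio fusc_double fusc_doubleS natrD.
have h : (0 : rat) < (fusc n.+1)%:R by rewrite ltr0n fusc_gt0.
have h' : (0 : rat) <= (fusc n)%:R by [].
move: h h'; move: (fusc n.+1)%:R (fusc n)%:R => u v h h'.
by field; rewrite !gt_eqF //=; lra.
Qed.

Lemma fusc_ratio_doubleS n : fusc_ratio n.*2.+1 = fusc_ratio n + 1.
Proof.
rewrite /fusc_ratio -doubleS fusc_double fusc_doubleS natrD.
have h : (0 : rat) < (fusc n.+1)%:R by rewrite ltr0n fusc_gt0.
by field; rewrite gt_eqF.
Qed.

Lemma fusc_ratio_inj : injective fusc_ratio.
Proof.
move=> m n; elim/ltn_ind: m n => m IH n.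
have dbl k : ~~ odd k -> k = k./2.*2%N by lia.
have dblS k : odd k -> k = k./2.*2.+1%N by lia.
have lt1 k : fusc_ratio k.*2 < 1.
  rewrite fusc_ratio_double; have := fusc_ratio_ge0 k => h.
  by rewrite ltr_pdivrMr; lra.
have ge1 k : 1 <= fusc_ratio k.*2.+1.
  by rewrite fusc_ratio_doubleS; have := fusc_ratio_ge0 k; lra.
have [->|m0] := posnP m.
  have [-> //|/fusc_ratio_gt0] := posnP n.
  by rewrite fusc_ratio0 => h e; move: h; rewrite -e ltxx.
have [om|om] := boolP (odd m); have [on|on] := boolP (odd n).
- rewrite [m]dblS // [n]dblS // !fusc_ratio_doubleS => /addIr /IH -> //; lia.
- rewrite [m]dblS // [n]dbl // => e.
  by have := lt1 n./2; rewrite -e ltNge ge1.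
- rewrite [m]dbl // [n]dblS // => e.
  by have := lt1 m./2; rewrite e ltNge ge1.
rewrite {1}[m]dbl // {1}[n]dbl // !fusc_ratio_double => e.
have hm := fusc_ratio_ge0 m./2; have hn := fusc_ratio_ge0 n./2.
rewrite [m]dbl // [n]dbl //; congr _.*2; apply: IH; first by lia.
have nz (x : rat) : 0 <= x -> 1 + x != 0 by move=> ?; rewrite gt_eqF //; lra.
move/eqP: e; rewrite eqr_div ?nz // !mulrDr !mulr1.
by rewrite [fusc_ratio n./2 * _]mulrC => /eqP/addIr.
Qed.

Lemma fusc_ratio_ex (r : rat) : 0 <= r -> exists n, r = fusc_ratio n.
Proof.
move: r; apply: rat_ge0_ind => a b hb IH.
have hb' : (0 : rat) < b%:R by rewrite ltr0n.
have [->|ha] := posnP a; first by exists 0%N; rewrite fusc_ratio0 mul0r.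
have ha' : (0 : rat) < a%:R by rewrite ltr0n.
have [hab|hab] := leqP b a.
  have [n hn] : exists n, (a - b)%N%:R / b%:R = fusc_ratio n by apply: IH; lia.
  exists n.*2.+1; rewrite fusc_ratio_doubleS -hn natrB //.
  by field; rewrite gt_eqF.
have [n hn] : exists n, a%:R / (b - a)%N%:R = fusc_ratio n by apply: IH; lia.
exists n.*2; rewrite fusc_ratio_double -hn natrB //; last exact: ltnW.
have h : a%:R < b%:R :> rat by rewrite ltr_nat.
by field; rewrite !gt_eqF //=; lra.
Qed.

(* The index n with S_r = P_n; a junk value if r < 0. *)
Definition snake_index (r : rat) : nat :=
  xget 0%N [set n | r = (fusc n)%:R / (fusc n.+1)%:R]%classic.

Lemma snake_indexP (r : rat) (n : nat) : 0 <= r ->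
  snake_index r = n <-> r = (fusc n)%:R / (fusc n.+1)%:R.
Proof.
move=> /fusc_ratio_ex[k hk]; rewrite /snake_index -/(fusc_ratio n).
case: xgetP => [m _ /= hm|/(_ k)]; last by rewrite /= -/(fusc_ratio k).
split=> [<- //|e]; by apply: fusc_ratio_inj; rewrite -e.
Qed.

(* [[r]]_q *)
Definition snake_qrat (K : fieldType) (q : K) (r : rat) : K :=
  i_gf (snake_index r) q / o_gf (snake_index r) q.

Fixpoint cf_val (s : seq nat) : rat :=
  match s with
  | [::] => 0
  | [:: a] => a%:R
  | a :: t => a%:R + (cf_val t)^-1
  end.

Definition regular_cf (s : seq nat) : bool :=
  (s != [::]) && all (leq 1) (behead s).

Definition even_cf_of (r : rat) (s : seq nat) : Prop :=
  [/\ regular_cf s, ~~ odd (size s) & cf_val s = r].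

Definition qint (K : fieldType) (q : K) (a : nat) : K := \sum_(i < a) q ^+ i.

(* Passing to the next level of the fraction replaces q by q^-1. *)
Fixpoint qcf (K : fieldType) (q : K) (s : seq nat) : K :=
  match s with
  | [::] => 0
  | [:: a] => qint q a
  | a :: t => qint q a + q ^+ a / qcf q^-1 t
  end.

(* [r]_q; a junk value if r < 0. *)
Definition mgo_qrat (K : fieldType) (q : K) (r : rat) : K :=
  if r == 0 then 0 else qcf q (xget [::] [set s | even_cf_of r s]%classic).

Lemma cf_val_cons a b t : cf_val (a :: b :: t) = a%:R + (cf_val (b :: t))^-1.
Proof. by []. Qed.

Lemma cf_val_tail b t : (0 < b)%N -> all (leq 1) t ->
  1 <= cf_val (b :: t) /\ (odd (size t) -> 1 < cf_val (b :: t)).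
Proof.
elim: t b => [|c t IH] b hb /=; first by rewrite ler1n.
case/andP=> hc ht; have [h _] := IH c hc ht.
have h1 : (1 : rat) <= b%:R by rewrite ler1n.
have h2 : 0 < (cf_val (c :: t))^-1 by rewrite invr_gt0; lra.
by split=> [|_]; rewrite -/(cf_val (c :: t)); lra.
Qed.

Lemma cf_val_inj s t : regular_cf s -> regular_cf t ->
  odd (size s) = odd (size t) -> cf_val s = cf_val t -> s = t.
Proof.
have natlt (a b : nat) (u v : rat) : 0 <= u <= 1 -> 0 <= v <= 1 ->
    (u == 0) = false -> (v == 0) = false -> a%:R + u = b%:R + v -> a = b.
  move=> /andP[u0 u1] /andP[v0 v1] nu nv e.
  have u0' : 0 < u by rewrite lt_def nu.
  have v0' : 0 < v by rewrite lt_def nv.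
  have h1 : a%:R < b.+1%:R :> rat by rewrite -natr1; lra.
  have h2 : b%:R < a.+1%:R :> rat by rewrite -natr1; lra.
  by move: h1 h2; rewrite !ltr_nat; lia.
have single (a b c : nat) t' : regular_cf (b :: c :: t') ->
    odd (size (b :: c :: t')) -> cf_val (b :: c :: t') <> a%:R.
  rewrite /regular_cf /= => /andP[hc ht] ho.
  rewrite -/(cf_val (c :: t')).
  have [_ h] := cf_val_tail hc ht.
  have {}h : 1 < cf_val (c :: t') by apply: h; lia.
  have h1 : 0 < (cf_val (c :: t'))^-1 by rewrite invr_gt0; lra.
  have h2 : (cf_val (c :: t'))^-1 < 1 by rewrite invf_lt1; lra.
  move=> e.
  have h3 : b%:R < a%:R :> rat by lra.
  have h4 : a%:R < b.+1%:R :> rat by rewrite -natr1; lra.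
  by move: h3 h4; rewrite !ltr_nat; lia.
elim: s t => // a s IH [//|b t].
case: s IH => [|c s] IH; case: t => [|d t] hs ht ho.
- by move=> /= /eqP; rewrite eqr_nat => /eqP ->.
- by move=> e; exfalso; apply: (@single a _ _ _ ht) => //; rewrite -ho.
- by move=> e; exfalso; apply: (@single b _ _ _ hs) => //; rewrite ho.
rewrite !cf_val_cons => e.
have /andP[hc hs'] : (0 < c)%N && all (leq 1) s by [].
have /andP[hd ht'] : (0 < d)%N && all (leq 1) t by [].
have [x1 _] := cf_val_tail hc hs'; have [y1 _] := cf_val_tail hd ht'.
have eab : a = b.
  by apply: natlt e; rewrite ?invr_eq0 ?gt_eqF ?invr_ge0 ?invf_le1; lra.
move: e; rewrite eab => /addrI /invr_inj e.
congr cons; apply: IH => //; move: ho => /=; lia.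
Qed.

Lemma cf_ex (r : rat) (e : bool) : 0 < r ->
  exists s, [/\ regular_cf s, odd (size s) = e & cf_val s = r].
Proof.
move=> r0; have := r0; move: r {r0} (ltW r0) e.
apply: (@rat_ge0_ind (fun r : rat => forall e : bool, 0 < r ->
  exists s, [/\ regular_cf s, odd (size s) = e & cf_val s = r])).
move=> a b hb IH e.
have hb' : (0 : rat) < b%:R by rewrite ltr0n.
have [->|ha] := posnP a; first by rewrite mul0r ltxx.
have ha' : (0 : rat) < a%:R by rewrite ltr0n.
move=> _; have succ (c d : nat) : (0 < c)%N -> (0 < d)%N -> (c + d < a + b)%N ->
    forall e : bool, exists x s, [/\ regular_cf (x.+1 :: s),
      odd (size (x.+1 :: s)) = e & cf_val (x.+1 :: s) = c%:R / d%:R + 1].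
  move=> hc hd h e'.
  have h0 : (0 : rat) < c%:R / d%:R by rewrite divr_gt0 ?ltr0n.
  have [[|x s] [h1 h2 h3]] := IH c d hd h e' h0.
    by [].
  exists x, s; split=> //; rewrite -h3.
  by case: s {h1 h2 h3} => [|y s]; rewrite ?cf_val_cons /= -natr1 //; ring.
have [hab|hab|hab] := ltngtP b a.
- have [|||x [s [h1 h2 h3]]] := succ (a - b)%N b _ _ _ e; try lia.
  exists (x.+1 :: s); split=> //; rewrite h3 natrB; last exact: ltnW.
  by field; rewrite gt_eqF.
- have [|||x [s [h1 h2 h3]]] := succ (b - a)%N a _ _ _ (~~ e); try lia.
  exists [:: 0%N, x.+1 & s]; split=> //; first by move: h2 => /=; lia.
  rewrite cf_val_cons h3 add0r natrB; last exact: ltnW.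
  by field; rewrite !gt_eqF //=; lra.
rewrite hab divff ?gt_eqF // -?hab //.
by case: e; [exists [:: 1%N] | exists [:: 0%N; 1%N]]; split.
Qed.

Lemma even_cf_unique (r : rat) : 0 < r -> exists! s, even_cf_of r s.
Proof.
move=> /(cf_ex false)[s [h1 /negbT h2 h3]]; exists s; split=> // t [g1 g2 g3].
by apply: cf_val_inj => //; [rewrite (negbTE h2) (negbTE g2) | rewrite h3].
Qed.

(* Main.v *)
Require Import Defs.
From mathcomp Require Import all_boot all_order all_algebra reals.
From mathcomp Require Import ring lra zify.
From mathcomp Require classical_sets.

Set Implicit Arguments.
Unset Strict Implicit.
Unset Printing Implicit Defensive.

Import Order.TTheory GRing.Theory Num.Theory.
Local Open Scope ring_scope.

(** Write q-weights of filters as i_n + o_n, split by whether 0 is included, and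
    set Q_n = i_n / o_n.  The binary expansions of 2n and 2n+1 are that of n
    with a digit 0 or 1 put in front, so P_2n and P_(2n+1) are P_n with all its
    elements shifted by one and a new element 0 placed below, respectively
    above, the old one.  A filter of the larger poset is a filter of P_n and a
    choice for the new element; the only new constraint is between the new and
    the old 0.  Hence
      i_2n = q i_n,            o_2n = i_n + o_n   (n > 0),
      i_(2n+1) = q (i_n + o_n),  o_(2n+1) = o_n,
    that is, Q_2n = q Q_n / (1 + Q_n) and Q_(2n+1) = q (Q_n + 1)
    ([snake_ratio_double], [snake_ratio_doubleS]); the first also holds for
    n = 0, where both sides vanish.

    The indices move in step: if r is the fusc ratio of n, those of 2n and
    2n+1 are r / (1 + r) and r + 1.  On the other side, the continued fraction
    gives [r + 1]_q = q [r]_q + 1 and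
    [r / (1 + r)]_q = q [r]_q / (1 + q [r]_q)
    ([mgo_qratD1], [mgo_qrat_harmonic]).  So q [r]_q obeys the recursion of Q_n,
    with the same value 0 at the start, and the two agree by strong induction
    on n ([snake_ratioE]). *)

(** * Filters as subsets closed along each covering relation *)

(** The order of a snake enters only through neighbouring elements, with
    directions read off from [w].  Keeping the size and the direction word as
    independent parameters lets the first element be peeled off without
    transporting sets between the carriers of different snakes. *)
Definition stepwise k (w : nat -> bool) (F : {set 'I_k}) : bool :=
  [forall i : 'I_k, forall j : 'I_k, (j == i.+1 :> nat) ==>
    (if w i then (j \in F) ==> (i \in F) else (i \in F) ==> (j \in F))].

Definition has0 k (F : {set 'I_k}) : bool := [exists x in F, x == 0%N :> nat].

Lemma stepwiseP k (w : nat -> bool) (F : {set 'I_k}) :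
  reflect (forall i j : 'I_k, j = i.+1 :> nat ->
             if w i then (j \in F) ==> (i \in F) else (i \in F) ==> (j \in F))
          (stepwise w F).
Proof.
apply: (iffP forallP) => [h i j /eqP e|h i].
  by have /forallP/(_ j)/implyP/(_ e) := h i.
by apply/forallP => j; apply/implyP => /eqP; apply: h.
Qed.

Lemma eq_stepwise k (w w' : nat -> bool) (F : {set 'I_k}) :
  w =1 w' -> stepwise w F = stepwise w' F.
Proof.
by move=> e; apply: eq_forallb => i; apply: eq_forallb => j; rewrite e.
Qed.

Lemma has0E k (F : {set 'I_k}) (i : 'I_k) :
  i = 0%N :> nat -> has0 F = (i \in F).
Proof.
move=> i0; apply/existsP/idP => [[x /andP[xF /eqP x0]]|iF].
  by have <- : x = i by apply: val_inj; rewrite /= x0.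
by exists i; rewrite iF i0.
Qed.

Lemma has0S k (F : {set 'I_k.+1}) : has0 F = (ord0 \in F).
Proof. exact: has0E. Qed.

Lemma has0_I0 (F : {set 'I_0}) : has0 F = false.
Proof. by apply/existsP => -[[]]. Qed.

(** The snake order is the reflexive transitive closure of its covering
    relation, so closure along single covers propagates along paths. *)
Lemma filter_stepwise n (F : {set snake n}) :
  is_filter F = stepwise (bit n) (F : {set 'I_(snake_size n)}).
Proof.
apply/idP/stepwiseP => [/forallP hF i j ij|hF].
  have up (x y : snake n) : snake_cover x y -> x \in F -> y \in F.
    move=> xy xF; have /implyP/(_ xF)/forallP/(_ y)/implyP := hF x.
    by apply; rewrite snake_leE connect1.
  case: ifP => b; apply/implyP; apply: up;
    by rewrite /snake_cover /snake_val ij b eqxx ?orbT.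
apply/forallP => x; apply/implyP => xF; apply/forallP => y; apply/implyP.
rewrite snake_leE => /connectP[p hp ->].
elim: p x xF hp => //= z p IH x xF /andP[xz]; apply: IH.
case/orP: xz => /andP[/eqP e b]; have := hF _ _ e.
  by rewrite (negbTE b) => /implyP; apply.
by rewrite b => /implyP; apply.
Qed.

(** * Generating functions and removal of the first element *)

Definition fence_gf (K : fieldType) k (w : nat -> bool) (b : bool) (q : K) :=
  \sum_(F : {set 'I_k} | stepwise w F && (has0 F == b)) q ^+ #|F|.

Lemma eq_fence_gf (K : fieldType) k (w w' : nat -> bool) b (q : K) :
  w =1 w' -> fence_gf k w b q = fence_gf k w' b q.
Proof. by move=> e; apply: eq_bigl => F; rewrite (eq_stepwise _ e). Qed.

Lemma i_gf_fence (K : fieldType) n (q : K) :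
  i_gf n q = fence_gf (snake_size n) (bit n) true q.
Proof. by apply: eq_bigl => F; rewrite filter_stepwise eqb_id. Qed.

Lemma o_gf_fence (K : fieldType) n (q : K) :
  o_gf n q = fence_gf (snake_size n) (bit n) false q.
Proof. by apply: eq_bigl => F; rewrite filter_stepwise eqbF_neg. Qed.

Definition set_cons k (b : bool) (G : {set 'I_k}) : {set 'I_k.+1} :=
  [set i | if unlift ord0 i is Some j then j \in G else b].

Definition set_behead k (F : {set 'I_k.+1}) : {set 'I_k} :=
  [set j | lift ord0 j \in F].

Lemma set_cons0 k b (G : {set 'I_k}) : (ord0 \in set_cons b G) = b.
Proof. by rewrite inE unlift_none. Qed.

Lemma set_cons_lift k b (G : {set 'I_k}) j :
  (lift ord0 j \in set_cons b G) = (j \in G).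
Proof. by rewrite inE liftK. Qed.

Lemma set_consK k b : cancel (@set_cons k b) (@set_behead k).
Proof. by move=> G; apply/setP => j; rewrite inE set_cons_lift. Qed.

Lemma set_beheadK k b (F : {set 'I_k.+1}) :
  has0 F = b -> set_cons b (set_behead F) = F.
Proof.
rewrite has0S => e; apply/setP => i; rewrite inE.
by case: unliftP => [j ->|->]; rewrite ?inE.
Qed.

Lemma card_set_cons k b (G : {set 'I_k}) : #|set_cons b G| = (b + #|G|)%N.
Proof.
rewrite -!sum1_card big_mkcond big_ord_recl /= set_cons0 [in RHS]big_mkcond /=.
by congr (_ + _)%N; apply: eq_bigr => j _; rewrite set_cons_lift.
Qed.

(** Only the cover between positions 0 and 1 is new.  When [w 0] is false and
    [k = 0] there is no position 1, so the constraint [b ==> has0 G] would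
    wrongly forbid the new element; the side condition excludes this. *)
Lemma stepwise_cons k w b (G : {set 'I_k}) : w 0%N || (0 < k)%N ->
  stepwise w (set_cons b G) =
  stepwise (w \o succn) G && (if w 0%N then has0 G ==> b else b ==> has0 G).
Proof.
move=> hk; apply/stepwiseP/andP => [h|[/stepwiseP h h0] i j].
  split.
    apply/stepwiseP => i j ij; have := h (lift ord0 i) (lift ord0 j).
    by rewrite !set_cons_lift; apply; rewrite /= /bump /= ij.
  case: k G h hk => [|k] G h hk.
    by move: hk; rewrite orbF has0_I0 => ->.
  have := h ord0 (lift ord0 ord0) erefl.
  by rewrite set_cons0 set_cons_lift has0S.
case: (unliftP ord0 j) => [j' ->|->] //.
case: (unliftP ord0 i) => [i' ->|->] e; last first.
  rewrite set_cons0 set_cons_lift.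
  by case: e => e; move: h0; rewrite (has0E _ e).
rewrite !set_cons_lift; apply: h; by case: e.
Qed.

(** Group the filters by their trace on positions 1, 2, ...; the status [c] of
    position 1 is all that the choice [b] at position 0 sees of it. *)
Lemma fence_gf_cons (K : fieldType) k w b (q : K) : w 0%N || (0 < k)%N ->
  fence_gf k.+1 w b q =
  q ^+ b * \sum_(c : bool | if w 0%N then c ==> b else b ==> c)
             fence_gf k (w \o succn) c q.
Proof.
move=> hk; rewrite /fence_gf.
rewrite (reindex_onto (@set_cons k b) (@set_behead k)) /=; last first.
  by move=> F /andP[_ /eqP]; exact: set_beheadK.
rewrite big_distrr /=.
rewrite (partition_big (@has0 k)
          (fun c : bool => if w 0%N then c ==> b else b ==> c)) /=; last first.
  by move=> G /andP[/andP[]]; rewrite stepwise_cons // => /andP[].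
apply: eq_bigr => c hc; rewrite big_distrr /=; apply: eq_big => [G|G _].
  rewrite stepwise_cons // has0S set_cons0 set_consK !eqxx !andbT.
  by case: eqP => [->|_]; rewrite ?andbF // hc !andbT.
by rewrite card_set_cons exprD.
Qed.

(** * The recursion for snakes *)

Lemma snake_size_double n : (0 < n)%N -> snake_size n.*2 = (snake_size n).+1.
Proof.
by move=> n0; rewrite /snake_size double_eq0 gtn_eqF // trunc_log2_double.
Qed.

Lemma snake_size_doubleS n : snake_size n.*2.+1 = (snake_size n).+1.
Proof.
case: n => [|n]; first by rewrite /snake_size trunc_log1.
by rewrite /snake_size trunc_log2S //= uphalf_double.
Qed.

Lemma snake_size_gt0 n : (0 < n)%N -> (0 < snake_size n)%N.
Proof. by rewrite /snake_size lt0n => /negbTE ->. Qed.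

Lemma bit0E n : bit n 0 = odd n.
Proof. by rewrite /bit expn0 divn1. Qed.

Lemma bitS n i : bit n i.+1 = bit n./2 i.
Proof. by rewrite /bit expnS divnMA divn2. Qed.

Lemma i_gf0 (K : fieldType) (q : K) : i_gf 0 q = 0.
Proof.
rewrite i_gf_fence /fence_gf big_pred0 // => F.
by rewrite (has0_I0 F) andbF.
Qed.

(** The new element lies below the old 0, so including it forces the old 0. *)
Lemma snake_gf_double (K : fieldType) n (q : K) : (0 < n)%N ->
  i_gf n.*2 q = q * i_gf n q /\ o_gf n.*2 q = i_gf n q + o_gf n q.
Proof.
move=> n0; have e b : fence_gf (snake_size n.*2) (bit n.*2) b q =
    q ^+ b * \sum_(c : bool | b ==> c) fence_gf (snake_size n) (bit n) c q.
  rewrite snake_size_double // fence_gf_cons ?snake_size_gt0 ?orbT //.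
  rewrite bit0E odd_double; congr (_ * _); apply: eq_bigr => c _.
  by apply: eq_fence_gf => i /=; rewrite bitS doubleK.
by rewrite !i_gf_fence !o_gf_fence !e; split;
  rewrite big_mkcond big_bool /= ?addr0 ?mul1r.
Qed.

(** The new element lies above the old 0, so omitting it forbids the old 0. *)
Lemma snake_gf_doubleS (K : fieldType) n (q : K) :
  i_gf n.*2.+1 q = q * (i_gf n q + o_gf n q) /\ o_gf n.*2.+1 q = o_gf n q.
Proof.
have e b : fence_gf (snake_size n.*2.+1) (bit n.*2.+1) b q =
    q ^+ b * \sum_(c : bool | c ==> b) fence_gf (snake_size n) (bit n) c q.
  have b0 : bit n.*2.+1 0 by rewrite bit0E /= odd_double.
  rewrite snake_size_doubleS fence_gf_cons b0 //.
  congr (_ * _); apply: eq_bigr => c _.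
  by apply: eq_fence_gf => i /=; rewrite bitS /= uphalf_double.
by rewrite !i_gf_fence !o_gf_fence !e; split;
  rewrite big_mkcond big_bool /= ?add0r ?mul1r.
Qed.

Lemma i_gf_ge0 (R : realFieldType) n (q : R) : 0 < q -> 0 <= i_gf n q.
Proof. by move=> q0; apply: sumr_ge0 => F _; rewrite exprn_ge0 // ltW. Qed.

(** The empty filter contributes 1. *)
Lemma o_gf_gt0 (R : realFieldType) n (q : R) : 0 < q -> 0 < o_gf n q.
Proof.
move=> q0; rewrite /o_gf (bigD1 set0) /=; last first.
  apply/andP; split; first by apply/forallP => x; rewrite inE.
  by apply/existsP => -[x]; rewrite inE.
rewrite ltr_wpDr ?exprn_gt0 //.
by apply: sumr_ge0 => F _; rewrite exprn_ge0 // ltW.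
Qed.

Lemma snake_ratio_double (R : realFieldType) n (q : R) : 0 < q ->
  i_gf n.*2 q / o_gf n.*2 q =
  q * (i_gf n q / o_gf n q) / (1 + i_gf n q / o_gf n q).
Proof.
case: (posnP n) => [-> _|n0 q0]; first by rewrite i_gf0 !(mul0r, mulr0).
have [-> ->] := snake_gf_double q n0.
have := i_gf_ge0 n q0; have := o_gf_gt0 n q0.
by move: (i_gf n q) (o_gf n q) => i o o0 i0; field; rewrite !gt_eqF //; lra.
Qed.

Lemma snake_ratio_doubleS (R : realFieldType) n (q : R) : 0 < q ->
  i_gf n.*2.+1 q / o_gf n.*2.+1 q = q * (i_gf n q / o_gf n q + 1).
Proof.
move=> q0; have [-> ->] := snake_gf_doubleS n q.
by have o0 := o_gf_gt0 n q0; field; rewrite gt_eqF.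
Qed.

(** * The recursion for q-rationals *)

Lemma mgo_qrat0 (K : fieldType) (q : K) : mgo_qrat q 0 = 0.
Proof. by rewrite /mgo_qrat eqxx. Qed.

(** Uniqueness of the regular expansion of even length makes any such expansion
    usable, so the two relations below follow by exhibiting expansions. *)
Lemma mgo_qratE (K : fieldType) (q : K) r s :
  0 < r -> even_cf_of r s -> mgo_qrat q r = qcf q s.
Proof.
move=> r0 hs; rewrite /mgo_qrat gt_eqF //; congr qcf.
have [u [_ uniq_u]] := even_cf_unique r0.
case: classical_sets.xgetP => [t _ /= ht|/(_ s)//].
by rewrite -(uniq_u s) // (uniq_u t).
Qed.

Lemma qint_gt0 (R : realFieldType) (q : R) a :
  0 < q -> (0 < a)%N -> 0 < qint q a.
Proof.
case: a => // a q0 _; rewrite /qint big_ord_recl ltr_wpDr // sumr_ge0 // => i _.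
by rewrite exprn_ge0 // ltW.
Qed.

Lemma qintS (K : fieldType) (q : K) a : qint q a.+1 = 1 + q * qint q a.
Proof.
rewrite /qint big_ord_recl expr0 big_distrr /=; congr (_ + _).
by apply: eq_bigr => i _; rewrite -exprS.
Qed.

Lemma qcf_cons (K : fieldType) (q : K) a b t :
  qcf q [:: a, b & t] = qint q a + q ^+ a / qcf q^-1 (b :: t).
Proof. by []. Qed.

Lemma qcf_succ (K : fieldType) (q : K) a t :
  qcf q (a.+1 :: t) = 1 + q * qcf q (a :: t).
Proof.
case: t => [|b t]; first exact: qintS.
by rewrite !qcf_cons qintS exprS; ring.
Qed.

Lemma qcf_0cons (K : fieldType) (q : K) b t :
  qcf q [:: 0%N, b & t] = (qcf q^-1 (b :: t))^-1.
Proof. by rewrite qcf_cons /qint big_ord0 add0r expr0 mul1r. Qed.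

Lemma qcf_gt0 (R : realFieldType) (q : R) b t :
  0 < q -> (0 < b)%N -> all (leq 1) t -> 0 < qcf q (b :: t).
Proof.
elim: t q b => [|c t IH] q b q0 b0; first by move=> _; exact: qint_gt0.
move=> /= /andP[c0 t0]; rewrite -/(qcf q^-1 (c :: t)).
by rewrite addr_gt0 ?qint_gt0 // divr_gt0 ?exprn_gt0 // IH // invr_gt0.
Qed.

Lemma cf_val_succ a t : cf_val (a.+1 :: t) = cf_val (a :: t) + 1.
Proof. by case: t => [|b t]; rewrite ?cf_val_cons /= -natr1 //; ring. Qed.

(** Adding 1 increments the first partial quotient of r > 0; at r = 0, where
    [0]_q is set apart from the continued fractions, use 1 = [0; 1]. *)
Lemma mgo_qratD1 (K : fieldType) (q : K) r : 0 <= r ->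
  mgo_qrat q (r + 1) = q * mgo_qrat q r + 1.
Proof.
rewrite le_eqVlt => /orP[/eqP <-|r0].
  rewrite mgo_qrat0 mulr0 add0r (@mgo_qratE _ _ _ [:: 0; 1]%N) //.
  by rewrite qcf_0cons /= qintS /qint big_ord0 mulr0 addr0 invr1 add0r.
have [[|a t] [[// ht es er] _]] := even_cf_unique r0.
rewrite (@mgo_qratE _ _ r (a :: t)) // (@mgo_qratE _ _ _ (a.+1 :: t)).
- by rewrite qcf_succ addrC.
- by rewrite addr_gt0.
by split=> //; rewrite cf_val_succ er.
Qed.

(** The map r |-> r / (1 + r) is inversion, adding 1, and inversion again.  On
    an expansion [0; b, ...] this increments [b]; on [a; ...] with [a > 0] it
    gives [0; 1, a, ...].  Both preserve the parity of the length.  Positivity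
    of [q] keeps the denominators away from 0. *)
Lemma mgo_qrat_harmonic (R : realFieldType) (q : R) r : 0 < q -> 0 <= r ->
  mgo_qrat q (r / (1 + r)) = q * mgo_qrat q r / (1 + q * mgo_qrat q r).
Proof.
move=> q0; rewrite le_eqVlt => /orP[/eqP <-|r0].
  by rewrite mul0r mgo_qrat0 mulr0 mul0r.
have r'0 : 0 < r / (1 + r) by rewrite divr_gt0 // addr_gt0.
have q'0 : 0 < q^-1 by rewrite invr_gt0.
have [[|a t] [[// ht es er] _]] := even_cf_unique r0.
rewrite (@mgo_qratE _ _ r (a :: t)) //.
case: a ht es er => [|a] ht es er; last first.
  have f0 := qcf_gt0 q0 (ltn0Sn a) ht.
  rewrite (@mgo_qratE _ _ _ [:: 0, 1, a.+1 & t]%N) //.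
    rewrite qcf_0cons qcf_succ qcf_0cons invrK.
    move: (qcf q (a.+1 :: t)) f0 => f f0; field.
    by rewrite !gt_eqF //= ?addr_gt0 ?mulr_gt0.
  split=> //; first by move: es => /=; rewrite !negbK.
  rewrite cf_val_cons cf_val_cons er; field.
  by rewrite !gt_eqF //= addr_gt0.
case: t ht es er => [//|b t] ht es er.
have /andP[b0 t0] : (0 < b)%N && all (leq 1) t by [].
have f0 := qcf_gt0 q'0 b0 t0.
rewrite (@mgo_qratE _ _ _ [:: 0, b.+1 & t]%N) //.
  rewrite !qcf_0cons qcf_succ.
  move: (qcf q^-1 (b :: t)) f0 => f f0; field.
  by rewrite !gt_eqF //= ?addr_gt0 ?mulr_gt0.
split=> //; rewrite cf_val_cons cf_val_succ -er cf_val_cons.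
have [v1 _] := cf_val_tail b0 t0.
by move: (cf_val (b :: t)) v1 => v v1; field; rewrite !gt_eqF //=; lra.
Qed.

(** * Comparison *)

Lemma snake_ratioE (R : realFieldType) n (q : R) : 0 < q ->
  i_gf n q / o_gf n q = q * mgo_qrat q (fusc_ratio n).
Proof.
move=> q0; elim/ltn_ind: n => n IH.
have [->|n0] := posnP n.
  by rewrite fusc_ratio0 mgo_qrat0 i_gf0 mul0r mulr0.
have lt : (n./2 < n)%N by lia.
have [on|on] := boolP (odd n).
  have -> : n = n./2.*2.+1 by lia.
  rewrite snake_ratio_doubleS // IH // fusc_ratio_doubleS.
  by rewrite mgo_qratD1 ?fusc_ratio_ge0.
have -> : n = n./2.*2 by lia.
rewrite snake_ratio_double // IH // fusc_ratio_double.
by rewrite mgo_qrat_harmonic ?fusc_ratio_ge0 // !mulrA.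
Qed.

Theorem proposition3p6 (R : realType) (r : rat) (hr : 0 <= r) (q : R)
  (hq : 0 < q) : snake_qrat q r = q * mgo_qrat q r.
Proof.
have [n rn] := fusc_ratio_ex hr.
have idx : snake_index r = n by apply/snake_indexP.
by rewrite /snake_qrat idx snake_ratioE // -rn.
Qed.
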